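(* The decision problem ARRIVAL is in $\mathrm{NP}$.
   Context: A switch graph is a 4-tuple $G=(V,E,s_0,s_1)$ where $V$ is a finite vertex set, $n=|V|$, $s_0,s_1:V\to V$, and $E=\{(v,s_0(v)):v\in V\}\cup\{(v,s_1(v)):v\in V\}$ (loops allowed; possibly $s_0(v)=s_1(v)$). The procedure $\textsc{Run}(G,o,d)$: maintain arrays $\mathtt{s\_curr},\mathtt{s\_next}$ indexed by $V$, initially $\mathtt{s\_curr}[v]=s_0(v)$, $\mathtt{s\_next}[v]=s_1(v)$; set $v:=o$; while $v\neq d$: $w:=\mathtt{s\_curr}[v]$, swap $\mathtt{s\_curr}[v],\mathtt{s\_next}[v]$, $v:=w$ (traversing edge $(v,w)$). ARRIVAL is the decision problem: given a switch graph $G$ (encoded by the maps $s_0,s_1$) and $o,d\in V$, does $\textsc{Run}(G,o,d)$ terminate? *)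

(* Defs.v *)
From mathcomp Require Import all_boot.
Unset Printing Implicit Defensive.

(* A switch graph G = (V, E, s0, s1) with V = {0,...,n-1}; the edge set E
   is determined by s0, s1. *)
Record switch_graph := SwitchGraph {
  sg_n  : nat;
  sg_s0 : 'I_sg_n -> 'I_sg_n;
  sg_s1 : 'I_sg_n -> 'I_sg_n }.

Record arrival_instance := ArrivalInstance {
  ai_G : switch_graph;
  ai_o : 'I_(sg_n ai_G);
  ai_d : 'I_(sg_n ai_G) }.

(* State of Run: current vertex v, arrays s_curr and s_next. *)
Definition run_state (n : nat) : Type :=
  ('I_n * ('I_n -> 'I_n) * ('I_n -> 'I_n))%type.

Definition run_init (G : switch_graph) (o : 'I_(sg_n G)) : run_state (sg_n G) :=
  (o, sg_s0 G, sg_s1 G).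

Definition run_body (n : nat) (st : run_state n) : run_state n :=
  let: (v, cur, nxt) := st in
  let w := cur v in
  (w, (fun u => if u == v then nxt v else cur u),
      (fun u => if u == v then cur v else nxt u)).

(* Run(G,o,d) terminates iff after some number k of loop iterations the
   current vertex equals d (the loop is exited the first time v = d). *)
Definition run_terminates (I : arrival_instance) : Prop :=
  exists k : nat, (iter k (@run_body (sg_n (ai_G I))) (@run_init (ai_G I) (ai_o I))).1.1 = ai_d I.

Definition bitstring := seq bool.

Fixpoint bits_fuel (fuel k : nat) : bitstring :=
  match fuel with
  | 0 => [::]
  | f.+1 => if k is 0 then [::] else odd k :: bits_fuel f k./2
  end.
Definition bits (k : nat) : bitstring := bits_fuel k k.

(* self-delimiting encoding: each digit b as (1,b), terminated by (0,0) *)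
Definition enc_nat (k : nat) : bitstring :=
  flatten [seq [:: true; b] | b <- bits k] ++ [:: false; false].

Definition enc_instance (I : arrival_instance) : bitstring :=
  let G := ai_G I in
  enc_nat (sg_n G) ++ enc_nat (ai_o I) ++ enc_nat (ai_d I) ++
  flatten [seq enc_nat (sg_s0 G v) ++ enc_nat (sg_s1 G v) | v <- enum 'I_(sg_n G)].

Definition ARRIVAL (w : bitstring) : Prop :=
  exists I : arrival_instance, w = enc_instance I /\ run_terminates I.

(* Machine model: deterministic multi-stack machines over {0,1}       *)
(* (polynomially equivalent to multi-tape Turing machines).           *)

Inductive instr :=
  | Push   (r : nat) (b : bool)
  | Pop    (r : nat) (je j0 j1 : nat)
  | Accept
  | Reject.

Definition program := seq instr.

Record config := Config { pc : nat; stacks : nat -> bitstring }.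

Definition upd_stack (s : nat -> bitstring) (r : nat) (l : bitstring) :=
  fun r' => if r' == r then l else s r'.

Definition cur_instr (p : program) (c : config) : instr := nth Reject p (pc c).

Definition mstep (p : program) (c : config) : config :=
  match cur_instr p c with
  | Push r b => Config (pc c).+1 (upd_stack (stacks c) r (b :: stacks c r))
  | Pop r je j0 j1 =>
      match stacks c r with
      | [::] => Config je (stacks c)
      | b :: l => Config (if b then j1 else j0) (upd_stack (stacks c) r l)
      end
  | Accept => c
  | Reject => c
  end.

Definition init_config (x y : bitstring) : config :=
  Config 0 (fun r => if r == 0 then x else if r == 1 then y else [::]).

Definition accepts_within (p : program) (t : nat) (x y : bitstring) : Prop :=
  cur_instr p (iter t (mstep p) (init_config x y)) = Accept.

Definition in_NP (L : bitstring -> Prop) : Prop :=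
  exists (p : program) (c k : nat),
    forall x : bitstring,
      L x <-> exists y : bitstring,
        size y <= c * (size x).+1 ^ k /\
        accepts_within p (c * (size x + size y).+1 ^ k) x y.

(* Main.v *)
(* A certificate is a switching flow: visit counts [t] such that every vertex [v]
   satisfies [v = o] + sum over u <> d of (ceil(t u / 2) if s0 u = v) +
   (floor(t u / 2) if s1 u = v) <= t v.  By induction along the run, each vertex
   is visited at most [t v] times, so the run stops after at most [sum t] steps.
   Conversely the visit counts of a terminating run form such a flow, and they
   are below n * 2^n + 1 because the run is a walk without repetition in the space
   of pairs (vertex, switch positions).  The inequalities are checked in binary,
   column by column, with guessed carries, which remain at most 3n + 1.
   All other guessed numbers (start, length and successive halves of each
   number encoded in the input) are at most the input size too, so the certificate
   is a table of numbers in unary, and the verification condition is an arithmetic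
   expression with bounded sums over bits of the input and of the certificate.
   Such an expression has a polynomially bounded value, and is evaluated in
   unary by nested loops in polynomial time. *)
Require Import Defs.
From mathcomp Require Import all_boot.
From mathcomp Require Import zify.
From Stdlib Require Import FunctionalExtensionality.

Set Implicit Arguments.
Unset Strict Implicit.
Unset Printing Implicit Defensive.

(** * Parsing the input *)

Lemma bits_fuel_enough f k : k <= f -> bits_fuel f k = bits k.
Proof.
have h a b c : c <= a -> c <= b -> bits_fuel a c = bits_fuel b c.
  elim: a b c => [|a IH] [|b] [|c] //= ha hb.
  by congr cons; apply: IH; lia.
by move=> hk; apply: h.
Qed.

Lemma bitsE k : 0 < k -> bits k = odd k :: bits k./2.
Proof.
case: k => // k _; have h : k.+1./2 <= k by lia.
by rewrite -(bits_fuel_enough h).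
Qed.

Lemma enc_natE k : 0 < k -> enc_nat k = true :: odd k :: enc_nat k./2.
Proof. by move=> hk; rewrite /enc_nat bitsE. Qed.

Lemma size_enc_nat k : size (enc_nat k) = 2 * size (bits k) + 2.
Proof.
by rewrite size_cat size_flatten /shape -map_comp /=; elim: (bits k) => //= b s IH; lia.
Qed.

(** [r j] stands for the encoded number without its [j] lowest digits. Positivity of [r j] below [l]
    forces the top digit to be 1, so only canonical encodings pass. *)
Definition block_ok (x : bitstring) (p l : nat) (r : nat -> nat) : Prop :=
  (forall j, j < l -> [/\ nth false x (p + 2 * j),
     r j = nth false x (p + 2 * j + 1) + 2 * r j.+1 & 0 < r j]) /\
  [/\ nth false x (p + 2 * l) = false, nth false x (p + 2 * l + 1) = false & r l = 0].

(** Induction on [l] peels off the lowest digit. The bound by [size x] matters because [nth] returns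
    [false] past the end, which would pass for a terminator. *)
Lemma block_sound x p l r : block_ok x p l r -> p + 2 * l + 2 <= size x ->
  drop p x = enc_nat (r 0) ++ drop (p + 2 * l + 2) x.
Proof.
elim: l p r => [|l IH] p r [h [h0 h1 hr]] hx.
  rewrite muln0 addn0 in h0 h1 hx *.
  rewrite addn1 in h1; rewrite hr [LHS](drop_nth false); last by lia.
  by rewrite (drop_nth false (n := p.+1)) ?h0 ?h1 ?addn2; last by lia.
have [hb hr0 hpos] := h 0 isT; rewrite muln0 addn0 in hb hr0.
have -> : p + 2 * l.+1 + 2 = p.+2 + 2 * l + 2 by lia.
rewrite [LHS](drop_nth false); last by lia.
rewrite (drop_nth false (n := p.+1)); last by lia.
rewrite hb.
rewrite (IH p.+2 (fun j => r j.+1)); last by lia.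
  rewrite (enc_natE hpos) hr0 addn1 !cat_cons; congr [:: _, _ & _ ++ _].
    by rewrite mul2n oddD odd_double addbF oddb.
  by rewrite mul2n half_bit_double.
split=> [j hj|].
  have [] := h j.+1 hj; have -> : p + 2 * j.+1 = p.+2 + 2 * j by lia.
  by [].
by split=> //; [rewrite -h0 | rewrite -h1]; congr nth; lia.
Qed.

Definition parse_ok (x : bitstring) (K : nat) (P L : nat -> nat) (R : nat -> nat -> nat) :=
  [/\ P 0 = 0, P K = size x &
    forall k, k < K -> P k.+1 = P k + 2 * L k + 2 /\ block_ok x (P k) (L k) (R k)].

Lemma parse_sound x K P L R : parse_ok x K P L R ->
  x = flatten [seq enc_nat (R k 0) | k <- iota 0 K].
Proof.
move=> [h0 hK h].
(* The induction runs backwards from the last number: [P K = size x] then bounds each end position,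
   as [block_sound] requires. *)
suff hi i k : k + i = K ->
    P k <= size x /\ drop (P k) x = flatten [seq enc_nat (R j 0) | j <- iota k i].
  by have [_] := hi K 0 (add0n K); rewrite h0 drop0.
elim: i k => [|i IH] k; rewrite ?addn0 => hk.
  by rewrite hk hK drop_size.
have [|hP hd] := IH k.+1; first lia.
have [|hPk hb] := h k; first lia.
split; first by lia.
by rewrite (block_sound hb) -hPk // hd.
Qed.

Lemma block_complete x p v s : drop p x = enc_nat v ++ s ->
  block_ok x p (size (bits v)) (fun j => v %/ 2 ^ j).
Proof.
move hl : (size (bits v)) => l.
elim: l v hl p => [|l IH] v.
  case: (posnP v) => [-> _ p hd|/bitsE -> //].
  by split=> //; rewrite muln0 addn0 div0n -{1}(addn0 p) -!nth_drop hd.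
case: (posnP v) => [-> //|hv]; rewrite (bitsE hv) => -[hl] p.
rewrite (enc_natE hv) => hd.
have hd2 : drop p.+2 x = enc_nat v./2 ++ s by rewrite -[p.+2]/(2 + p) -drop_drop hd /= drop0.
have {IH}[h [h0 h1 hr]] := IH _ hl p.+2 hd2.
have hS j : v %/ 2 ^ j.+1 = v./2 %/ 2 ^ j by rewrite expnS divnMA divn2.
split=> [[_|j hj]|].
- rewrite muln0 -addnA -!nth_drop hd hS !expn0 !divn1 /=; split=> //.
  by rewrite mul2n odd_double_half.
- rewrite !hS (_ : p + 2 * j.+1 = p.+2 + 2 * j); last by lia.
  exact: h.
- by rewrite hS (_ : p + 2 * l.+1 = p.+2 + 2 * l); [split | lia].
Qed.

(** Needed because the decoded certificate agrees with the intended tables on a bounded range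
    only. *)
Lemma parse_ok_ext x K P L R P' L' R' :
  (forall k, k <= K -> P' k = P k) -> (forall k, k < K -> L' k = L k) ->
  (forall k j, k < K -> j <= L k -> R' k j = R k j) ->
  parse_ok x K P L R -> parse_ok x K P' L' R'.
Proof.
move=> hP hL hR [h0 hK h]; split=> [||k hk]; first by rewrite hP.
  by rewrite hP.
have [hPS [hb [e0 e1 e2]]] := h k hk; rewrite hP // (hP _ (ltnW hk)) hL //; split=> //.
split=> [j hj|]; last by rewrite hR.
by have [? ? ?] := hb j hj; rewrite !hR // ltnW.
Qed.

(** Each number occupies at least its two terminator bits. For [K = 2 * n + 3] this puts [2 * n + 3]
    and the carry bound [3 * n + 1] below [size x]. *)
Lemma parse_ok_size x K P L R : parse_ok x K P L R -> 2 * K <= size x.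
Proof.
move=> [h0 <- h]; suff hi i : i <= K -> 2 * i <= P i by exact: hi.
elim: i => [|i IH] hi; first by rewrite muln0.
by have := IH (ltnW hi); have [-> _] := h i hi; lia.
Qed.

Lemma parse_complete V K (x := flatten [seq enc_nat (V k) | k <- iota 0 K]) :
  exists P L, [/\ forall k, k <= K -> P k <= size x, forall k, k < K -> L k <= size x &
    parse_ok x K P L (fun k j => V k %/ 2 ^ j)].
Proof.
pose P k := size (flatten [seq enc_nat (V i) | i <- iota 0 k]).
have hx k : k <= K -> x = flatten [seq enc_nat (V i) | i <- iota 0 k] ++
    flatten [seq enc_nat (V i) | i <- iota k (K - k)].
  by move=> hk; rewrite -flatten_cat -map_cat -iotaD subnKC.
have hP k : k <= K -> P k <= size x by move=> hk; rewrite (hx _ hk) size_cat leq_addr.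
have hPS k : P k.+1 = P k + 2 * size (bits (V k)) + 2.
  by rewrite /P -addn1 iotaD map_cat flatten_cat size_cat /= cats0 size_enc_nat add0n addnA.
exists P, (fun k => size (bits (V k))); split=> // [k hk|].
  by have := hP _ hk; rewrite hPS; lia.
split=> // k hk; split=> //.
apply: (@block_complete _ _ _ (flatten [seq enc_nat (V i) | i <- iota k.+1 (K - k.+1)])).
by rewrite (hx k (ltnW hk)) drop_size_cat // -subnSK.
Qed.

Definition numbering (I : arrival_instance) (V : nat -> nat) : Prop :=
  [/\ V 0 = sg_n (ai_G I), V 1 = ai_o I, V 2 = ai_d I &
   forall u : 'I_(sg_n (ai_G I)),
     V (3 + 2 * u) = sg_s0 _ u /\ V (4 + 2 * u) = sg_s1 _ u].

Lemma enc_instanceE I V : numbering I V ->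
  enc_instance I = flatten [seq enc_nat (V k) | k <- iota 0 (2 * sg_n (ai_G I) + 3)].
Proof.
case: I => -[n s0 s1] o d [/= h0 h1 h2 hs]; rewrite /enc_instance /=.
move: enc_nat => e; rewrite addnC iotaD map_cat flatten_cat /= h0 h1 h2 cats0 -!catA.
do 3![congr (_ ++ _)].
transitivity (flatten [seq e (V (3 + 2 * u)) ++ e (V (4 + 2 * u)) | u <- iota 0 n]).
  rewrite -val_enum_ord -map_comp; apply: (congr1 flatten); apply: eq_map => u /=.
  by have [-> ->] := hs u.
elim: n {s0 s1 o d h0 h1 h2 hs} => // n IH.
rewrite -[n.+1 in LHS]addn1 iotaD map_cat flatten_cat IH.
have -> : 2 * n.+1 = 2 * n + 2 by lia.
rewrite iotaD map_cat flatten_cat.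
by rewrite /= !cats0 !add0n.
Qed.

(** * Runs and switching flows *)

Section Run.
Variables (n : nat) (s0 s1 : 'I_n -> 'I_n) (o d : 'I_n).

Definition state i : run_state n := iter i (@run_body n) (o, s0, s1).
Definition pos i : 'I_n := (state i).1.1.
Definition departures i (u : 'I_n) : nat := \sum_(j < i) (pos j == u).

Lemma departuresS i u : departures i.+1 u = departures i u + (pos i == u).
Proof. by rewrite /departures big_ord_recr. Qed.

(** Each departure from [u] flips its switch, so parities determine both arrays. *)
Lemma state_parity i u :
  ((state i).1.2 u = if odd (departures i u) then s1 u else s0 u) /\
  ((state i).2 u = if odd (departures i u) then s0 u else s1 u).
Proof.
elim: i u => [|i IH] u; first by rewrite /departures big_ord0.
rewrite departuresS oddD /pos /state iterS -/(state i).
have := IH u; case: (state i) => [[v cur] nxt] /= [hc hx].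
rewrite eq_sym; case: eqP => [e|_] /=; last by rewrite addbF.
by rewrite e hc hx addbT; case: odd.
Qed.

Lemma posS i : pos i.+1 =
  if odd (departures i (pos i)) then s1 (pos i) else s0 (pos i).
Proof.
rewrite -(state_parity i (pos i)).1 /pos /state iterS -/(state i).
by case: (state i) => [[]].
Qed.

Definition inflow (t : 'I_n -> nat) (v : 'I_n) : nat :=
  (v == o) + \sum_u ((s0 u == v) * uphalf (t u) + (s1 u == v) * (t u)./2).

(** A vertex is occupied once if it is the start, and once per traversal of an entering edge.
    Departures from [u] alternate, beginning with [s0 u], which thus receives the larger half. *)
Lemma visitsE i v : departures i.+1 v = inflow (departures i) v.
Proof.
elim: i => [|i IH].
  rewrite departuresS /departures big_ord0 /inflow add0n eq_sym big1 ?addn0 // => u _.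
  by rewrite /departures big_ord0 !muln0.
rewrite departuresS IH posS /inflow -addnA; congr addn.
(* One more departure from [pos i] raises [uphalf] or [./2] of its count by one, according to the
   parity that selects the edge. *)
rewrite (bigD1 (pos i)) //= [in RHS](bigD1 (pos i)) //= addnAC.
congr addn; last first.
  by apply: eq_bigr => u hu; rewrite departuresS [pos i == u]eq_sym (negbTE hu) addn0.
rewrite departuresS eqxx addn1; move: (departures i (pos i)) => q.
rewrite /= !uphalf_half; case: odd => /=; lia.
Qed.

Lemma inflow_le t t' v : (forall u, t u <= t' u) -> inflow t v <= inflow t' v.
Proof.
move=> h; rewrite leq_add2l; apply: leq_sum => u _; apply: leq_add.
  by rewrite leq_mul2l; apply/orP; right; have := h u; lia.
by rewrite leq_mul2l half_leq ?orbT.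
Qed.

(** The run stops at [d], so nothing flows out of it. *)
Definition absorb (t : 'I_n -> nat) (u : 'I_n) : nat := if u == d then 0 else t u.

(** Before [d] is reached, [departures i] stays below [absorb t], and monotonicity of [inflow]
    passes the bound on to the next time. *)
Lemma departures_le t : (forall v, inflow (absorb t) v <= t v) ->
  forall i, (forall j, j < i -> pos j != d) -> forall v, departures i.+1 v <= t v.
Proof.
move=> ht; elim=> [|i IH] hi v; rewrite visitsE; apply: leq_trans (ht v); apply: inflow_le => u.
  by rewrite /departures big_ord0.
rewrite /absorb; case: eqP => [->|_]; last by apply: IH => j hj; apply: hi; lia.
by rewrite /departures big1 // => j _; rewrite (negbTE (hi _ _)).
Qed.

Lemma sum_departures i : \sum_u departures i u = i.
Proof.
rewrite exchange_big /= -[RHS](card_ord i) -sum1_card; apply: eq_bigr => j _.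
by rewrite (bigD1 (pos j)) //= eqxx big1 // => u; rewrite eq_sym => /negbTE ->.
Qed.

Lemma flow_terminates t : (forall v, inflow (absorb t) v <= t v) -> exists k, pos k = d.
Proof.
move=> ht; set N := \sum_u t u.
case: (boolP [exists i : 'I_N, pos i == d]) => [/existsP[i /eqP hi]|]; first by exists i.
rewrite negb_exists => /forallP h.
have hN j : j < N -> pos j != d by move=> hj; exact: (h (Ordinal hj)).
(* The visits at times 0 to [N] number [N.+1], while at most [t u] of them fall on each [u]. *)
have : N.+1 <= N by rewrite -{1}(sum_departures N.+1); apply: leq_sum => u _; exact: departures_le.
by rewrite ltnn.
Qed.

(** The counts at [k] and [k.+1] differ only by the visit to [d], which [absorb] discards. *)
Lemma terminates_flow k : pos k = d -> (forall j, j < k -> pos j != d) ->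
  forall v, departures k.+1 v = inflow (absorb (departures k.+1)) v.
Proof.
move=> hk hj v; rewrite visitsE; congr addn; apply: eq_bigr => u _.
suff -> : absorb (departures k.+1) u = departures k u by [].
rewrite /absorb; case: eqP => [->|/eqP hu].
  by rewrite /departures big1 // => j _; rewrite (negbTE (hj _ _)).
by rewrite departuresS hk eq_sym (negbTE hu) addn0.
Qed.

Lemma departures_leq i v : departures i v <= i.
Proof.
rewrite -[X in _ <= X]muln1 -[X in X * 1]card_ord -sum_nat_const.
by apply: leq_sum => j _; case: eqP.
Qed.

(* The run is a walk of a deterministic system on pairs (vertex, switch positions). *)
Lemma terminates_fast k : pos k = d -> exists2 k', k' < n * 2 ^ n & pos k' = d.
Proof.
pose step (c : 'I_n * {ffun 'I_n -> bool}) :=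
  (if c.2 c.1 then s1 c.1 else s0 c.1, [ffun u => (u == c.1) (+) c.2 u]).
pose conf i := iter i step (o, [ffun=> false]).
have hconf i : conf i = (pos i, [ffun u => odd (departures i u)]).
  elim: i => [|i IH].
    by congr pair; apply/ffunP => u; rewrite !ffunE /departures big_ord0.
  rewrite /conf iterS -/(conf i) IH /step /= ffunE posS; congr pair.
  by apply/ffunP => u; rewrite !ffunE departuresS oddD addbC eq_sym; case: eqP.
move=> hk; set c0 := conf 0.
have hc : fconnect step c0 (conf k) by exact: fconnect_iter.
(* [findex] is the first occurrence of the configuration, hence below the size of the orbit. *)
exists (findex step c0 (conf k)).
  apply: leq_trans (findex_max hc) _; apply: leq_trans (max_card _) _.
  by rewrite card_prod card_ffun card_bool !card_ord.
have := iter_findex hc; rewrite -/(conf _) !hconf => -[-> _].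
exact: hk.
Qed.

End Run.

(* Column-wise binary verification of [inflow (absorb t) v <= t v]: [T j v] is
   the [j]-th digit of [t v] and [C j v] the carry into column [j]. *)
Definition flow_ok (n o d : nat) (s0 s1 : nat -> nat) (M : nat) (T C : nat -> nat -> nat) :=
  forall v, v < n ->
  [/\ T 0 v <= 1, T M v = 0, C M v = 0,
    (v == o) + \sum_(u < n) (u != d :> nat) * (s0 u == v) * T 0 u <= C 0 v &
    forall j, j < M ->
      C j v + \sum_(u < n) (u != d :> nat) * T j.+1 u * ((s0 u == v) + (s1 u == v))
        <= T j v + 2 * C j.+1 v].

Lemma flow_ok_ext n o d S0 S1 S0' S1' M T C T' C' :
  (forall u, u < n -> S0' u = S0 u) -> (forall u, u < n -> S1' u = S1 u) ->
  (forall j v, j <= M -> v < n -> T' j v = T j v) ->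
  (forall j v, j <= M -> v < n -> C' j v = C j v) ->
  flow_ok n o d S0 S1 M T C -> flow_ok n o d S0' S1' M T' C'.
Proof.
move=> h0 h1 hT hC h v hv; have [t0 tM cM c0 hj] := h v hv.
rewrite !hT ?hC //; split=> // [|j hjM].
  by under eq_bigr => u _ do rewrite h0 // hT //.
rewrite !hC // ?hT //; last exact: ltnW; last exact: ltnW.
by under eq_bigr => u _ do rewrite h0 // h1 // hT //; apply: hj.
Qed.

Section Flow.
Variables (n : nat) (o d : 'I_n) (s0 s1 : 'I_n -> 'I_n) (S0 S1 : nat -> nat) (M : nat).
Hypotheses (hS0 : forall u : 'I_n, S0 u = s0 u) (hS1 : forall u : 'I_n, S1 u = s1 u).

Let edges (u v : 'I_n) : nat := (S0 u == v) + (S1 u == v).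

(** Both edges out of [u] carry the half [h u]; only the edge to [s0 u] also carries the parity bit
    [e u]. Hence the lowest digits enter [flow_ok] separately, and column [j] uses digit [j.+1]. *)
Lemma inflow_split (t h e : 'I_n -> nat) (v : 'I_n) :
  (forall u, uphalf (t u) = e u + h u) -> (forall u, (t u)./2 = h u) ->
  inflow s0 s1 o (absorb d t) v =
  (v == o :> nat) + \sum_(u < n) (u != d :> nat) * (S0 u == v) * e u
    + \sum_(u < n) (u != d :> nat) * h u * edges u v.
Proof.
move=> hu hh; rewrite /inflow -addnA; congr addn; rewrite -big_split; apply: eq_bigr => u _ /=.
rewrite /absorb /edges hS0 hS1 !val_eqE; case: (u == d); first by rewrite /= !muln0.
by rewrite hu hh; case: (s0 u == v); case: (s1 u == v) => /=; lia.
Qed.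

Lemma flow_sound T C : flow_ok n o d S0 S1 M T C ->
  exists t, forall v : 'I_n, inflow s0 s1 o (absorb d t) v <= t v.
Proof.
move=> hok; pose t (v : 'I_n) := \sum_(j < M) T j v * 2 ^ j.
pose h (v : 'I_n) := \sum_(j < M) T j.+1 v * 2 ^ j.
have ht v : t v = T 0 v + 2 * h v.
  have [_ hM _ _ _] := hok v (ltn_ord v).
  have -> : t v = \sum_(j < M.+1) T j v * 2 ^ j by rewrite big_ord_recr /= hM addn0.
  rewrite big_ord_recl muln1 big_distrr /=; congr addn; apply: eq_bigr => j _.
  by rewrite /bump /= add1n expnS mulnCA.
exists t => v; rewrite (@inflow_split t h (fun u => T 0 u)); last first.
- by move=> u; have [? _ _ _ _] := hok u (ltn_ord u); rewrite ht; lia.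
- by move=> u; have [? _ _ _ _] := hok u (ltn_ord u); rewrite ht; lia.
have [_ _ hC h0 hj] := hok v (ltn_ord v).
pose A j := \sum_(u < n) (u != d :> nat) * T j.+1 u * edges u v.
have hA : \sum_(u < n) (u != d :> nat) * h u * edges u v = \sum_(j < M) A j * 2 ^ j.
  under [RHS]eq_bigr => j _ do rewrite big_distrl.
  rewrite exchange_big; apply: eq_bigr => u _ /=.
  rewrite /h big_distrr big_distrl; apply: eq_bigr => j _ /=.
  by rewrite -!mulnA; congr muln; congr muln; rewrite mulnC.
(* Summing the column inequalities with weights [2 ^ j] cancels the inner carries; [C M v = 0]
   disposes of the last one. *)
have hm m : m <= M ->
    C 0 v + \sum_(j < m) A j * 2 ^ j <= \sum_(j < m) T j v * 2 ^ j + C m v * 2 ^ m.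
  elim: m => [|m IH] hm; first by rewrite !big_ord0 muln1 addn0.
  have := IH (ltnW hm); rewrite !big_ord_recr /= expnS.
  have := leq_mul (hj m hm) (leqnn (2 ^ m)); rewrite -/(A m) !mulnDl.
  lia.
have := hm M (leqnn M); rewrite hC mul0n addn0 hA; apply: leq_trans.
by rewrite leq_add2r.
Qed.

Lemma flow_complete (t : nat -> nat) :
  (forall v : 'I_n, t v = inflow s0 s1 o (absorb d (fun u : 'I_n => t u)) v) ->
  (forall v, v < n -> t v < 2 ^ M) ->
  exists T C, [/\ flow_ok n o d S0 S1 M T C, forall j v, v < n -> T j v <= 1 &
    forall j v, j <= M -> v < n -> C j v <= 3 * n + 1].
Proof.
move=> ht hM; pose tj j v := t v %/ 2 ^ j; pose T j v : nat := odd (tj j v).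
pose D j v := \sum_(u < n) (u != d :> nat) * tj j.+1 u * ((S0 u == v) + (S1 u == v)).
(* The carry into column [j] is what the shifted count retains beyond the inflow [D j v] of the
   shifted counts. *)
pose C j v := tj j v - D j v.
have tjS j v : tj j v = T j v + 2 * tj j.+1 v.
  by rewrite /T /tj expnSr divnMA divn2 mul2n odd_double_half.
pose A j v := \sum_(u < n) (u != d :> nat) * T j.+1 u * ((S0 u == v) + (S1 u == v)).
have hDA j v : D j v = A j v + 2 * D j.+1 v.
  rewrite /D /A big_distrr -big_split; apply: eq_bigr => u _ /=.
  by rewrite (tjS j.+1) /=; case: (_ != _) => /=; lia.
pose c0 v := (v == o :> nat) + \sum_(u < n) (u != d :> nat) * (S0 u == v) * T 0 u.
have htD v : v < n -> t v = c0 v + D 0 v.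
  move=> hv; rewrite -[v]/(val (Ordinal hv)) [LHS]ht.
  rewrite (@inflow_split _ (fun u : 'I_n => tj 1 u) (fun u : 'I_n => T 0 u)) // => u.
    by have := tjS 0 u; rewrite {1}/tj divn1 /T /tj divn1 uphalf_half => {1}->; lia.
  by rewrite /tj divn2.
(* Rounding each summand down loses at least as much as rounding the total, so the subtraction in
   [C] is not truncated. *)
have hD j v : v < n -> D j v <= tj j v.
  move=> hv; rewrite /tj leq_divRL ?expn_gt0 // (htD v hv).
  apply: leq_trans (leq_addl _ _); rewrite /D big_distrl; apply: leq_sum => u _ /=.
  rewrite -!mulnA [X in _ * X]mulnCA leq_mul2l; apply/orP; right.
  rewrite [in X in _ <= X]mulnC leq_mul2l; apply/orP; right.
  by rewrite /tj expnS divnMA leq_trunc_div.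
have hCS j v : v < n -> C j v + A j v = T j v + 2 * C j.+1 v.
  by move=> hv; rewrite /C; have := hD j v hv; have := hD j.+1 v hv; have := tjS j v;
     have := hDA j v; lia.
have hC0 v : v < n -> C 0 v = c0 v.
  by move=> hv; rewrite /C /tj divn1 htD // addnK.
have hsum (F : 'I_n -> nat) b : (forall u, F u <= b) -> \sum_(u < n) F u <= n * b.
  by move=> hF; rewrite -[n in n * b]card_ord -sum_nat_const; apply: leq_sum => u _.
exists T, C; split; last 1 first.
(* The next carry is at most half of the current one, plus [n], so the bound persists from the
   initial [n + 1]. *)
- move=> j v + hv; elim: j => [_|j IH hj].
    rewrite hC0 // /c0 addnC -[n in X in _ <= X]muln1.
    apply: leq_add; last by case: (v == o :> nat).
    apply: leq_trans (hsum _ 1 _) _; last by lia.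
    by move=> u; rewrite /T; case: (_ != _); case: odd; case: eqP.
  have := IH (ltnW hj); have := hCS j v hv.
  have : A j v <= n * 2.
    apply: hsum => u; rewrite /T; case: (_ != _); case: odd; case: eqP; case: eqP => //=.
  lia.
- move=> v hv; split=> [|||| j hj].
  + by rewrite /T; case: odd.
  + by rewrite /T /tj divn_small // hM.
  + by rewrite /C /tj divn_small // hM.
  + by rewrite hC0.
  + by rewrite hCS.
- by move=> j v hv; rewrite /T; case: odd.
Qed.

End Flow.

(** * Structured programs on the stack machine *)

Notation store := (nat -> bitstring).

Inductive cmd :=
  | CSkip
  | CPush (r : nat) (b : bool)
  | CSeq (c1 c2 : cmd)
  | CPop (r : nat) (c0 c1 : cmd)
  | CWhile (r : nat) (c0 c1 : cmd).

(** The number counts steps of the compiled code. A jump costs two: [CPop] pays it after the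
    0-branch only, which is laid out first, whereas [CWhile] pays it after either branch. *)
Inductive exec : cmd -> store -> nat -> store -> Prop :=
  | ESkip s : exec CSkip s 0 s
  | EPush r b s : exec (CPush r b) s 1 (upd_stack s r (b :: s r))
  | ESeq c1 c2 s t1 s1 t2 s2 :
      exec c1 s t1 s1 -> exec c2 s1 t2 s2 -> exec (CSeq c1 c2) s (t1 + t2) s2
  | EPopNil r c0 c1 s : s r = [::] -> exec (CPop r c0 c1) s 1 s
  | EPopCons r c0 c1 s b l t s' :
      s r = b :: l -> exec (if b then c1 else c0) (upd_stack s r l) t s' ->
      exec (CPop r c0 c1) s (1 + t + (if b then 0 else 2)) s'
  | EWhileNil r c0 c1 s : s r = [::] -> exec (CWhile r c0 c1) s 1 s
  | EWhileCons r c0 c1 s b l t1 s1 t2 s2 :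
      s r = b :: l -> exec (if b then c1 else c0) (upd_stack s r l) t1 s1 ->
      exec (CWhile r c0 c1) s1 t2 s2 ->
      exec (CWhile r c0 c1) s (1 + t1 + 2 + t2) s2.

(* The machine has no unconditional jump: push a bit and pop it again. *)
Definition jump (j : nat) : program := [:: Push 0 true; Pop 0 j j j].

Fixpoint compile (c : cmd) (a : nat) : program :=
  match c with
  | CSkip => [::]
  | CPush r b => [:: Push r b]
  | CSeq c1 c2 =>
      let p1 := compile c1 a in p1 ++ compile c2 (a + size p1)
  | CPop r c0 c1 =>
      let p0 := compile c0 a.+1 in
      let a1 := a.+1 + size p0 + 2 in
      let p1 := compile c1 a1 in
      Pop r (a1 + size p1) a.+1 a1 :: p0 ++ jump (a1 + size p1) ++ p1
  | CWhile r c0 c1 =>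
      let p0 := compile c0 a.+1 in
      let a1 := a.+1 + size p0 + 2 in
      let p1 := compile c1 a1 in
      Pop r (a1 + size p1 + 2) a.+1 a1 :: p0 ++ jump a ++ p1 ++ jump a
  end.

Definition code_at (p : program) (a : nat) (q : program) : Prop :=
  forall i, i < size q -> nth Reject p (a + i) = nth Reject q i.

Lemma code_at_cat p a q1 q2 :
  code_at p a (q1 ++ q2) -> code_at p a q1 /\ code_at p (a + size q1) q2.
Proof.
move=> H; split=> i hi.
- by rewrite H ?nth_cat ?hi // size_cat; lia.
- rewrite -addnA H ?size_cat; last by lia.
  by rewrite nth_cat ltnNge leq_addr /= addKn.
Qed.

Lemma code_at_cons p a i q :
  code_at p a (i :: q) -> nth Reject p a = i /\ code_at p a.+1 q.
Proof.
move=> /(@code_at_cat p a [:: i]) [H1 H2]; split; last by rewrite -addn1.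
by have := H1 0 isT; rewrite addn0.
Qed.

Lemma upd_stack_same s r l : upd_stack s r l r = l.
Proof. by rewrite /upd_stack eqxx. Qed.

Lemma upd_stack_other s r l k : k != r -> upd_stack s r l k = s k.
Proof. by rewrite /upd_stack => /negbTE ->. Qed.

Lemma upd_stack_upd s r l l' : upd_stack (upd_stack s r l) r l' = upd_stack s r l'.
Proof. by apply: functional_extensionality => k; rewrite /upd_stack; case: eqP. Qed.

Lemma upd_stack_id s r : upd_stack s r (s r) = s.
Proof. by apply: functional_extensionality => k; rewrite /upd_stack; case: eqP => // ->. Qed.

Lemma jump_iter p a j s : code_at p a (jump j) ->
  iter 2 (mstep p) (Config a s) = Config j s.
Proof.
move=> /code_at_cons [H1 /code_at_cons [H2 _]].
rewrite /= {2}/mstep /cur_instr /= H1 /mstep /cur_instr /= H2.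
by rewrite upd_stack_same upd_stack_upd upd_stack_id.
Qed.

(* Equations for [rewrite], as reduction would also unfold the inner calls. *)
Lemma compile_pop r c0 c1 a (a1 := a.+1 + size (compile c0 a.+1) + 2) :
  compile (CPop r c0 c1) a =
  Pop r (a1 + size (compile c1 a1)) a.+1 a1 ::
    compile c0 a.+1 ++ jump (a1 + size (compile c1 a1)) ++ compile c1 a1.
Proof. by []. Qed.

Lemma compile_while r c0 c1 a (a1 := a.+1 + size (compile c0 a.+1) + 2) :
  compile (CWhile r c0 c1) a =
  Pop r (a1 + size (compile c1 a1) + 2) a.+1 a1 ::
    compile c0 a.+1 ++ jump a ++ compile c1 a1 ++ jump a.
Proof. by []. Qed.

Lemma size_cons T (x : T) s : size (x :: s) = (size s).+1.
Proof. by []. Qed.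

Lemma size_jump j : size (jump j) = 2.
Proof. by []. Qed.

Lemma mstep_pop p a s r je j0 j1 : nth Reject p a = Pop r je j0 j1 ->
  mstep p (Config a s) = if s r is b :: l
    then Config (if b then j1 else j0) (upd_stack s r l) else Config je s.
Proof. by rewrite /mstep /cur_instr /= => ->. Qed.

Lemma exec_compile c s t s' p a : exec c s t s' -> code_at p a (compile c a) ->
  iter t (mstep p) (Config a s) = Config (a + size (compile c a)) s'.
Proof.
move=> H; elim: H a => {c s t s'}.
- by move=> s a _; rewrite addn0.
- by move=> r b s a /code_at_cons [H _]; rewrite /= /mstep /cur_instr /= H addn1.
- move=> c1 c2 s t1 s1 t2 s2 _ IH1 _ IH2 a /code_at_cat [H1 H2].
  by rewrite addnC iterD IH1 // IH2 // size_cat addnA.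
- move=> r c0 c1 s hs a; rewrite compile_pop => /code_at_cons [/mstep_pop H _].
  rewrite [iter _ _ _]H hs size_cons !size_cat size_jump; congr Config; lia.
- move=> r c0 c1 s b l t s' hs _ IH a; rewrite compile_pop.
  move=> /code_at_cons [/mstep_pop H] /code_at_cat [H0] /code_at_cat [H1 H2].
  rewrite [1 + t + _]addnC add1n iterD iterSr H hs size_cons !size_cat size_jump.
  case: b hs IH => hs IH; rewrite IH //; last rewrite (jump_iter _ H1);
    congr Config; lia.
- move=> r c0 c1 s hs a; rewrite compile_while => /code_at_cons [/mstep_pop H _].
  rewrite [iter _ _ _]H hs size_cons !size_cat !size_jump; congr Config; lia.
- move=> r c0 c1 s b l t1 s1 t2 s2 hs _ IH1 _ IH2 a Hc.
  have := Hc; rewrite {1}compile_while => /code_at_cons [/mstep_pop H] /code_at_cat [H0].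
  move=> /code_at_cat [H1] /code_at_cat [H2 H3].
  have -> : 1 + t1 + 2 + t2 = t2 + (2 + t1.+1) by lia.
  rewrite iterD iterD (iterSr t1) H hs.
  case: b hs IH1 => hs IH1; rewrite IH1 //.
    by rewrite (jump_iter _ H3) IH2.
  by rewrite (jump_iter _ H1) IH2.
Qed.

Definition runs (c : cmd) (s s' : store) (T : nat) : Prop :=
  exists2 t, t <= T & exec c s t s'.

Lemma runs_while r c0 c1 n T (S : nat -> store) :
  S n r = [::] ->
  (forall i, i < n -> exists b l, S i r = b :: l /\
     runs (if b then c1 else c0) (upd_stack (S i) r l) (S i.+1) T) ->
  runs (CWhile r c0 c1) (S 0) (S n) (n * (T + 3) + 1).
Proof.
elim: n S => [|n IH] S hn hS; first by exists 1 => //; exact: EWhileNil.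
have [b [l [hs [t1 ht1 h1]]]] := hS 0 isT.
have [t2 ht2 h2] := IH (fun i => S i.+1) hn (fun i hi => hS i.+1 hi).
by exists (1 + t1 + 2 + t2); [lia | exact: (EWhileCons hs h1 h2)].
Qed.

(** * Running times as powers of a fixed base *)

Section PolyTime.
Variable X : nat.
Hypothesis X2 : 2 <= X.

Lemma expX_le a b : a <= b -> X ^ a <= X ^ b.
Proof. by move=> h; rewrite leq_exp2l. Qed.

Lemma expX_gt0 a : 0 < X ^ a.
Proof. by rewrite expn_gt0; lia. Qed.

(** Each power is at most [X ^ (a + b)], and one more [X] absorbs the factor 2. So composing
    programs amounts to adding exponents. *)
Lemma expX_add a b : X ^ a + X ^ b <= X ^ (a + b + 1).
Proof.
have h1 := expX_le (leq_addr b a); have h2 := expX_le (leq_addl a b).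
rewrite (expnD _ (a + b)) expn1; have := leq_mul (leqnn (X ^ (a + b))) X2; lia.
Qed.

Lemma expX2 : 4 <= X ^ 2.
Proof. by rewrite -mulnn; exact: leq_mul X2 X2. Qed.

Definition pruns c s s' e := runs c s s' (X ^ e).

Lemma pruns_weak c s s' e e' : e <= e' -> pruns c s s' e -> pruns c s s' e'.
Proof. by move=> h [t ht h1]; exists t => //; apply: leq_trans ht (expX_le h). Qed.

Lemma pruns_skip s : pruns CSkip s s 0.
Proof. by exists 0; [|exact: ESkip]. Qed.

Lemma pruns_push r b s : pruns (CPush r b) s (upd_stack s r (b :: s r)) 0.
Proof. by exists 1; [|exact: EPush]. Qed.

Lemma pruns_seq c1 c2 s s1 s2 e1 e2 :
  pruns c1 s s1 e1 -> pruns c2 s1 s2 e2 -> pruns (CSeq c1 c2) s s2 (e1 + e2 + 1).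
Proof.
move=> [t1 ht1 h1] [t2 ht2 h2]; exists (t1 + t2); last exact: ESeq h1 h2.
exact: leq_trans (leq_add ht1 ht2) (expX_add _ _).
Qed.

Lemma pruns_pop_nil r c0 c1 s : s r = [::] -> pruns (CPop r c0 c1) s s 0.
Proof. by exists 1; [|exact: EPopNil]. Qed.

Lemma pruns_pop_cons r c0 c1 s b l s' e : s r = b :: l ->
  pruns (if b then c1 else c0) (upd_stack s r l) s' e ->
  pruns (CPop r c0 c1) s s' (e + 3).
Proof.
move=> hs [t ht h]; exists (1 + t + (if b then 0 else 2)); last exact: EPopCons hs h.
have := expX_add e 2; have := expX2.
have -> : e + 2 + 1 = e + 3 by lia.
by clear h; case: (b); lia.
Qed.

Lemma pruns_while r c0 c1 n (S : nat -> store) a b :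
  n <= X ^ a -> S n r = [::] ->
  (forall i, i < n -> exists d l, S i r = d :: l /\
     pruns (if d then c1 else c0) (upd_stack (S i) r l) (S i.+1) b) ->
  pruns (CWhile r c0 c1) (S 0) (S n) (a + b + 4).
Proof.
move=> hn h0 hS; have [t ht h] := runs_while h0 hS; exists t => //.
apply: leq_trans ht _.
have h1 : X ^ b + 3 <= X ^ (b + 3).
  have := expX_add b 2; have := expX2.
  have -> : b + 2 + 1 = b + 3 by lia.
  lia.
have := leq_mul hn h1; rewrite -expnD => h2.
have := expX_add (a + (b + 3)) 0.
have -> : a + (b + 3) + 0 + 1 = a + b + 4 by lia.
rewrite expn0; lia.
Qed.

End PolyTime.

(** * Arithmetic expressions with bounded sums *)

Inductive expr :=
  | Var (z : nat)
  | One
  | Add (a b : expr)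
  | Sub (a b : expr)
  | Mul (a b : expr)
  | Sum (z : nat) (a b : expr)
  | Bit (z : nat) (a : expr).

(* A variable holds a bitstring; read as a number, it denotes its length. *)
Fixpoint eval (env : nat -> bitstring) (e : expr) : nat :=
  match e with
  | Var z => size (env z)
  | One => 1
  | Add a b => eval env a + eval env b
  | Sub a b => eval env a - eval env b
  | Mul a b => eval env a * eval env b
  | Sum z a b => \sum_(i < eval env a) eval (upd_stack env z (nseq i true)) b
  | Bit z a => nth false (env z) (eval env a)
  end.

(** An exponent bounding the value when all variables have length at most [X]. In a sum, the index
    and the old variables fit below [X ^ (vexp a).+1], the base for the body; hence the product of
    exponents. *)
Fixpoint vexp (e : expr) : nat :=
  match e with
  | Var _ => 1
  | One => 0
  | Add a b => vexp a + vexp b + 1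
  | Sub a b => vexp a
  | Mul a b => vexp a + vexp b
  | Sum _ a b => vexp a + (vexp a).+1 * vexp b
  | Bit _ _ => 0
  end.

Lemma leq_expX_S X a b : 1 < X -> b <= X ^ a -> b <= X ^ a.+1.
Proof. by move=> hX /leq_trans -> //; apply: expX_le. Qed.

Lemma size_upd_env X v env z n : 1 < X -> (forall z, size (env z) <= X) ->
  n <= X ^ v -> forall z', size (upd_stack env z (nseq n true) z') <= X ^ v.+1.
Proof.
move=> hX henv hn z'; rewrite /upd_stack; case: eqP => _.
  by rewrite size_nseq leq_expX_S.
by apply: leq_trans (henv z') _; rewrite -[X in X <= _]expn1; apply: expX_le.
Qed.

Lemma eval_bound e X env : 1 < X -> (forall z, size (env z) <= X) ->
  eval env e <= X ^ vexp e.
Proof.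
elim: e X env => /= [z||a IHa b IHb|a IHa b IHb|a IHa b IHb|z a IHa b IHb|z a _]
  X env hX henv.
- by rewrite expn1.
- by [].
- exact: leq_trans (leq_add (IHa _ _ hX henv) (IHb _ _ hX henv)) (expX_add hX _ _).
- exact: leq_trans (leq_subr _ _) (IHa _ _ hX henv).
- by rewrite expnD leq_mul ?IHa ?IHb.
- have hX' : 1 < X ^ (vexp a).+1 by rewrite expnS; have := expX_gt0 hX (vexp a); nia.
  rewrite expnD expnM; apply: leq_trans (leq_mul (IHa _ _ hX henv) (leqnn _)).
  rewrite -[eval env a in X in _ <= X]card_ord -sum_nat_const; apply: leq_sum => i _.
  apply: IHb => // z'; apply: size_upd_env => //.
  exact: leq_trans (ltnW (ltn_ord i)) (IHa _ _ hX henv).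
- by case: nth.
Qed.

(** * Compilation of expressions *)

(** The bits are reversed, so a variable popped into scratch space and transferred back is
    restored. *)
Definition transfer (src dst : nat) : cmd :=
  CWhile src (CPush dst false) (CPush dst true).

(* [comp rho e r f] pushes [eval e] bits on stack [r], where variable [z] lives
   in stack [rho z] and the stacks from [f] on are empty scratch space. *)
Fixpoint comp (rho : nat -> nat) (e : expr) (r f : nat) : cmd :=
  match e with
  | Var z =>
      CSeq (CWhile (rho z) (CSeq (CPush f false) (CPush r true))
                           (CSeq (CPush f true) (CPush r true)))
           (transfer f (rho z))
  | One => CPush r true
  | Add a b => CSeq (comp rho a r f) (comp rho b r f)
  | Sub a b =>
      CSeq (comp rho a f f.+1)
      (CSeq (comp rho b f.+1 f.+2)
      (CSeq (CWhile f.+1 (CPop f CSkip CSkip) (CPop f CSkip CSkip))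
            (CWhile f (CPush r true) (CPush r true))))
  | Mul a b =>
      CSeq (comp rho a f f.+1)
           (CWhile f (comp rho b r f.+1) (comp rho b r f.+1))
  | Sum z a b =>
      let body := CSeq (comp (fun z' => if z' == z then f.+1 else rho z') b r f.+2)
                       (CPush f.+1 true) in
      CSeq (comp rho a f f.+1)
      (CSeq (CWhile f body body) (CWhile f.+1 CSkip CSkip))
  | Bit z a =>
      let shift := CPop (rho z) (CPush f.+1 false) (CPush f.+1 true) in
      CSeq (comp rho a f f.+1)
      (CSeq (CWhile f shift shift)
      (CSeq (CPop (rho z) (CPush (rho z) false)
                          (CSeq (CPush (rho z) true) (CPush r true)))
            (transfer f.+1 (rho z))))
  end.

(** The exponents keep the unsimplified form in which [pruns_seq], [pruns_pop_cons] and
    [pruns_while] produce them. The body of a sum runs over the larger base of [vexp]. *)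
Fixpoint texp (e : expr) : nat :=
  match e with
  | Var _ => 12
  | One => 0
  | Add a b => texp a + texp b + 1
  | Sub a b => texp a + (texp b + ((vexp b + 3 + 4) + (vexp a + 0 + 4) + 1) + 1) + 1
  | Mul a b => texp a + (vexp a + texp b + 4) + 1
  | Sum _ a b => texp a + ((vexp a + ((vexp a).+1 * texp b + 0 + 1) + 4)
                           + (vexp a + 0 + 4) + 1) + 1
  | Bit _ a => texp a + ((vexp a + 3 + 4) + (4 + 5 + 1) + 1) + 1
  end.

Ltac stores := apply: functional_extensionality => ?; rewrite /upd_stack;
  repeat (case: eqP => ?; subst => //=); try lia.

Lemma pruns_transfer X s src dst : 1 < X -> src <> dst -> size (s src) <= X ->
  pruns X (transfer src dst) s
    (upd_stack (upd_stack s src [::]) dst (rev (s src) ++ s dst)) 5.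
Proof.
move=> hX hne hs.
pose S i := upd_stack (upd_stack s src (drop i (s src))) dst
  (rev (take i (s src)) ++ s dst).
have -> : upd_stack (upd_stack s src [::]) dst (rev (s src) ++ s dst) = S (size (s src)).
  by rewrite /S drop_size take_size.
rewrite -[X in pruns _ _ X _](_ : S 0 = s); last first.
  by rewrite /S drop0 take0; stores.
apply: (@pruns_while X hX _ _ _ _ S 1 0); first by rewrite expn1.
  by rewrite /S drop_size /upd_stack eqxx; case: eqP.
move=> i hi; exists (nth false (s src) i), (drop i.+1 (s src)); split.
  by rewrite /S -drop_nth // /upd_stack eqxx; case: eqP.
have -> : S i.+1 = upd_stack (upd_stack (S i) src (drop i.+1 (s src))) dst
    (nth false (s src) i :: upd_stack (S i) src (drop i.+1 (s src)) dst).
  rewrite /S (take_nth false) // rev_rcons; stores.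
by case: nth; apply: pruns_push.
Qed.

Lemma nseq_sub T (x : T) n i : i < n -> nseq (n - i) x = x :: nseq (n - i.+1) x.
Proof. by move=> h; rewrite -subnSK. Qed.

Section CompSpec.
Variables (X : nat).
Hypothesis X2 : 1 < X.

(** The final store differs from [s] in [r] only: variables and scratch stacks are restored, so
    compiled subexpressions compose. *)
Definition comp_spec e := forall rho r f s env,
  (forall z, size (env z) <= X) -> r < f -> (forall z, rho z < f) ->
  (forall z, rho z <> r) -> (forall k, f <= k -> s k = [::]) ->
  (forall z, s (rho z) = env z) ->
  pruns X (comp rho e r f) s
    (upd_stack s r (nseq (eval env e) true ++ s r)) (texp e).

Lemma comp_var z : comp_spec (Var z).
Proof.
move=> rho r f s env henv hr hrho hne hf hs /=.
set l := env z; have hl : s (rho z) = l by rewrite hs.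
pose S i := upd_stack (upd_stack (upd_stack s (rho z) (drop i l)) f (rev (take i l)))
   r (nseq i true ++ s r).
have hz := hrho z; have hzr := hne z.
apply: (@pruns_seq X X2 _ _ _ (S (size l)) _ 6 5).
  rewrite -[X in pruns _ _ X _](_ : S 0 = s); last first.
    by rewrite /S drop0 take0; stores; rewrite hf.
  apply: (@pruns_while X X2 _ _ _ _ S 1 1); first by rewrite expn1 henv.
    rewrite /S drop_size /upd_stack eqxx; case: eqP => // _; case: eqP => //; lia.
  move=> i hi; exists (nth false l i), (drop i.+1 l); split.
    by rewrite /S -drop_nth // /upd_stack eqxx; case: eqP => // _; case: eqP => //; lia.
  have -> : S i.+1 = 
     let s1 := upd_stack (S i) (rho z) (drop i.+1 l) in 
     let s2 := upd_stack s1 f (nth false l i :: s1 f) in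
     upd_stack s2 r (true :: s2 r).
    rewrite /S (take_nth false) // rev_rcons; stores.
  by case: nth; apply: (@pruns_seq X X2 _ _ _ _ _ 0 0); apply: pruns_push.
have hSf : S (size l) f = rev l.
  rewrite /S take_size /upd_stack eqxx; case: eqP => //; lia.
have -> : upd_stack s r (nseq (size l) true ++ s r) =
  upd_stack (upd_stack (S (size l)) f [::]) (rho z) (rev (S (size l) f) ++ S (size l) (rho z)).
  rewrite hSf revK /S drop_size take_size; stores; rewrite ?cats0 ?hs ?hf //.
apply: pruns_transfer => //; first lia.
by rewrite hSf size_rev henv.
Qed.



Lemma comp_add a b : comp_spec a -> comp_spec b -> comp_spec (Add a b).
Proof.
move=> ha hb rho r f s env henv hr hrho hne hf hs /=.
apply: (pruns_seq X2 (ha _ _ _ _ _ henv hr hrho hne hf hs)).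
set s1 := upd_stack _ _ _.
have -> : upd_stack s r (nseq (eval env a + eval env b) true ++ s r) =
    upd_stack s1 r (nseq (eval env b) true ++ s1 r).
  by rewrite /s1 upd_stack_upd upd_stack_same addnC nseqD catA.
apply: hb => // [k hk|z]; rewrite /s1 upd_stack_other //.
- exact: hf.
- by apply/eqP; lia.
- by apply/eqP.
Qed.

Lemma comp_scratch a rho f s env : comp_spec a ->
  (forall z, size (env z) <= X) -> (forall z, rho z < f) ->
  (forall k, f <= k -> s k = [::]) -> (forall z, s (rho z) = env z) ->
  pruns X (comp rho a f f.+1) s (upd_stack s f (nseq (eval env a) true)) (texp a).
Proof.
move=> ha henv hrho hf hs.
rewrite -[nseq _ _]cats0 -(hf f) //; apply: ha => // [z|z|k hk].
- by have := hrho z; lia.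
- by have := hrho z; lia.
- by apply: hf; lia.
Qed.

Lemma comp_sub a b : comp_spec a -> comp_spec b -> comp_spec (Sub a b).
Proof.
move=> ha hb rho r f s env henv hr hrho hne hf hs /=.
apply: (pruns_seq X2 (comp_scratch ha henv hrho hf hs)).
set s1 := upd_stack _ _ _.
have hs1 z : s1 (rho z) = env z.
  by rewrite /s1 upd_stack_other //; apply/eqP; have := hrho z; lia.
apply: (pruns_seq X2 (comp_scratch (f := f.+1) hb henv _ _ hs1)) => [z|k hk|].
- by have := hrho z; lia.
- by rewrite /s1 upd_stack_other ?hf //; [lia | apply/eqP; lia].
have hva := eval_bound a X2 henv; have hvb := eval_bound b X2 henv.
set va := eval env a in s1 hs1 hva *; set vb := eval env b in hvb *.
clearbody va vb.
(* Both counters are popped together [vb] times; popping an empty [f] does nothing, which yields the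
   truncated difference. *)
pose S i := upd_stack (upd_stack s f (nseq (va - i) true)) f.+1 (nseq (vb - i) true).
have -> : upd_stack s1 f.+1 (nseq vb true) = S 0 by rewrite /S !subn0.
apply: (pruns_seq X2 (s1 := S vb)).
  apply: pruns_while => // [|i hi]; first by rewrite /S subnn upd_stack_same.
  exists true, (nseq (vb - i.+1) true); split; first by rewrite /S upd_stack_same nseq_sub.
  case: (ltnP i va) => hia; last first.
    rewrite (_ : S i.+1 = upd_stack (S i) f.+1 (nseq (vb - i.+1) true)); last first.
      by rewrite /S upd_stack_upd; congr upd_stack; congr upd_stack; congr nseq; lia.
    apply: (@pruns_weak X X2 _ _ _ 0) => //; apply: pruns_pop_nil.
    rewrite /S upd_stack_other; last by apply/eqP; lia.
    rewrite upd_stack_other; last by apply/eqP; lia.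
    by rewrite upd_stack_same (_ : va - i = 0) //; lia.
  apply: (@pruns_pop_cons X X2 _ _ _ _ true (nseq (va - i.+1) true) _ 0).
    rewrite /S upd_stack_other; last by apply/eqP; lia.
    rewrite upd_stack_other; last by apply/eqP; lia.
    by rewrite upd_stack_same nseq_sub.
  rewrite (_ : upd_stack _ _ _ = S i.+1); first exact: pruns_skip.
  by rewrite /S; stores.
pose S' i := upd_stack (upd_stack s f (nseq (va - vb - i) true)) r (nseq i true ++ s r).
have -> : S vb = S' 0 by rewrite /S /S' !subn0 subnn; stores; rewrite hf //; lia.
have -> : upd_stack s r (nseq (va - vb) true ++ s r) = S' (va - vb).
  by rewrite /S' subnn; stores; rewrite hf.
apply: pruns_while => // [||i hi]; first by lia.
  by rewrite /S' subnn upd_stack_other ?upd_stack_same //; apply/eqP; lia.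
exists true, (nseq (va - vb - i.+1) true); split.
  rewrite /S' upd_stack_other; last by apply/eqP; lia.
  by rewrite upd_stack_same nseq_sub.
set s2 := upd_stack _ _ _.
have -> : S' i.+1 = upd_stack s2 r (true :: s2 r) by rewrite /s2 /S'; stores.
exact: pruns_push.
Qed.

Lemma comp_mul a b : comp_spec a -> comp_spec b -> comp_spec (Mul a b).
Proof.
move=> ha hb rho r f s env henv hr hrho hne hf hs /=.
apply: (pruns_seq X2 (comp_scratch ha henv hrho hf hs)).
have hva := eval_bound a X2 henv.
set va := eval env a in hva *; set vb := eval env b.
pose S i := upd_stack (upd_stack s f (nseq (va - i) true)) r (nseq (i * vb) true ++ s r).
have -> : upd_stack s f (nseq va true) = S 0 by rewrite /S subn0; stores.
have -> : upd_stack s r (nseq (va * vb) true ++ s r) = S va.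
  by rewrite /S subnn; stores; rewrite hf.
apply: pruns_while => // [|i hi].
  by rewrite /S subnn upd_stack_other ?upd_stack_same //; apply/eqP; lia.
exists true, (nseq (va - i.+1) true); split.
  rewrite /S upd_stack_other; last by apply/eqP; lia.
  by rewrite upd_stack_same nseq_sub.
set s2 := upd_stack _ _ _.
have -> : S i.+1 = upd_stack s2 r (nseq vb true ++ s2 r).
  by rewrite /s2 /S mulSn nseqD -catA; stores.
apply: hb => // [|z|k hk|z]; first by lia.
- by have := hrho z; lia.
- rewrite /s2 /S upd_stack_other; last by apply/eqP; lia.
  by rewrite upd_stack_other ?upd_stack_other ?hf //; try (apply/eqP; lia); lia.
- have hz := hrho z; have hzr := hne z.
  rewrite /s2 /S upd_stack_other; last by apply/eqP; lia.
  by rewrite upd_stack_other ?upd_stack_other ?hs //; apply/eqP; lia.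
Qed.

Lemma comp_bit z a : comp_spec a -> comp_spec (Bit z a).
Proof.
move=> ha rho r f s env henv hr hrho hne hf hs /=.
apply: (pruns_seq X2 (comp_scratch ha henv hrho hf hs)).
have hva := eval_bound a X2 henv.
set va := eval env a in hva *; set l := env z.
have hz := hrho z; have hzr := hne z; have hsz : s (rho z) = l := hs z.
have hl : size l <= X by exact: henv.
(* Position [va] is reached by moving bits to [f.+1]; the next bit is copied to [r], and the moved
   bits are then put back. *)
pose S i := upd_stack (upd_stack (upd_stack s (rho z) (drop i l)) f (nseq (va - i) true))
  f.+1 (rev (take i l)).
have -> : upd_stack s f (nseq va true) = S 0.
  by rewrite /S subn0 drop0 take0; stores; rewrite hf.
apply: (pruns_seq X2 (s1 := S va)).
  apply: pruns_while => // [|i hi].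
    by rewrite /S subnn upd_stack_other ?upd_stack_same //; apply/eqP; lia.
  exists true, (nseq (va - i.+1) true); split.
    rewrite /S upd_stack_other; last by apply/eqP; lia.
  by rewrite upd_stack_same nseq_sub.
  have hSz : upd_stack (S i) f (nseq (va - i.+1) true) (rho z) = drop i l.
    rewrite /S; do 3![rewrite upd_stack_other; last by apply/eqP; lia].
    by rewrite upd_stack_same.
  case: (ltnP i (size l)) => hil.
    apply: (@pruns_pop_cons X X2 _ _ _ _ (nth false l i) (drop i.+1 l) _ 0).
      by rewrite hSz (drop_nth false).
    set s2 := upd_stack _ (rho z) _.
    have -> : S i.+1 = upd_stack s2 f.+1 (nth false l i :: s2 f.+1).
      by rewrite /s2 /S (take_nth false) // rev_rcons; stores.
    by case: nth; apply: pruns_push.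
  rewrite (_ : S i.+1 = upd_stack (S i) f (nseq (va - i.+1) true)); last first.
    by rewrite /S !drop_oversize ?take_oversize //; try lia; stores.
  by apply: (@pruns_weak X X2 _ _ _ 0) => //; apply: pruns_pop_nil; rewrite hSz drop_oversize.
have hSz : S va (rho z) = drop va l.
  rewrite /S; do 2![rewrite upd_stack_other; last by apply/eqP; lia].
  by rewrite upd_stack_same.
pose s3 := upd_stack (S va) r (nseq (nth false l va) true ++ s r).
have hSr : S va r = s r.
  by rewrite /S; do 3![rewrite upd_stack_other; last by apply/eqP; lia].
apply: (pruns_seq X2 (s1 := s3)).
  case: (ltnP va (size l)) => hil; last first.
    (* Past the end nothing is pushed, in agreement with the default of [nth]. *)
    rewrite /s3 nth_default //= -hSr upd_stack_id.
    by apply: (@pruns_weak X X2 _ _ _ 0) => //; apply: pruns_pop_nil; rewrite hSz drop_oversize.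
  apply: (@pruns_pop_cons X X2 _ _ _ _ (nth false l va) (drop va.+1 l) _ 1).
    by rewrite hSz (drop_nth false).
  set s2 := upd_stack _ (rho z) _.
  have hs2 : upd_stack s2 (rho z) (nth false l va :: s2 (rho z)) = S va.
    rewrite /s2 upd_stack_same -drop_nth // upd_stack_upd -hSz upd_stack_id //.
  rewrite /s3 -hs2; case: nth hs2 => hs2.
    apply: (@pruns_seq X X2 _ _ _ _ _ 0 0); first exact: pruns_push.
    by rewrite /= -hSr -hs2; apply: pruns_push.
  rewrite /= -hSr -hs2 upd_stack_id.
  by apply: (@pruns_weak X X2 _ _ _ 0) => //; apply: pruns_push.
have hS3 : s3 f.+1 = rev (take va l).
  rewrite /s3 /S upd_stack_other; last by apply/eqP; lia.
  by rewrite upd_stack_same.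
rewrite (_ : upd_stack s r _ =
  upd_stack (upd_stack s3 f.+1 [::]) (rho z) (rev (s3 f.+1) ++ s3 (rho z))).
  apply: pruns_transfer => //; first by lia.
  by rewrite hS3 size_rev size_take_min; lia.
have -> : s3 (rho z) = drop va l by rewrite /s3 upd_stack_other ?hSz //; apply/eqP.
rewrite hS3 revK cat_take_drop /s3 /S subnn; stores; rewrite ?hf //; lia.
Qed.

End CompSpec.

(** Stack [f.+1] holds the index, grows by one bit per round and is emptied at the end. As the index
    may exceed [X], the body must be correct for every base. *)
Lemma comp_sum X z a b : 1 < X -> comp_spec X a ->
  (forall Y, 1 < Y -> comp_spec Y b) -> comp_spec X (Sum z a b).
Proof.
move=> X2 ha hb rho r f s env henv hr hrho hne hf hs /=.
apply: (pruns_seq X2 (comp_scratch X2 ha henv hrho hf hs)).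
have hva := eval_bound a X2 henv.
set va := eval env a in hva *.
pose F i := eval (upd_stack env z (nseq i true)) b.
pose S i := upd_stack (upd_stack (upd_stack s f (nseq (va - i) true)) f.+1 (nseq i true))
  r (nseq (\sum_(j < i) F j) true ++ s r).
have -> : upd_stack s f (nseq va true) = S 0.
  by rewrite /S subn0 big_ord0; stores; rewrite hf.
have hclear : S va f.+1 = nseq va true.
  by rewrite /S upd_stack_other ?upd_stack_same //; apply/eqP; lia.
apply: (pruns_seq X2 (s1 := S va)).
  apply: pruns_while => // [|i hi].
    rewrite /S subnn; do 2![rewrite upd_stack_other; last by apply/eqP; lia].
    by rewrite upd_stack_same.
  exists true, (nseq (va - i.+1) true); split.
    rewrite /S; do 2![rewrite upd_stack_other; last by apply/eqP; lia].
    by rewrite upd_stack_same nseq_sub.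
  set s2 := upd_stack _ _ _.
  set s3 := upd_stack s2 r (nseq (F i) true ++ s2 r).
  have hs3 : S i.+1 = upd_stack s3 f.+1 (true :: s3 f.+1).
    by rewrite /S /s3 /s2 /S big_ord_recr /= addnC nseqD -catA; stores.
  suff h : pruns X (comp (fun z' => if z' == z then f.+1 else rho z') b r f.+2) s2 s3
      ((vexp a).+1 * texp b).
    by rewrite hs3; apply: (pruns_seq X2 h); apply: pruns_push.
  have hX' : 1 < X ^ (vexp a).+1 by rewrite expnS; have := expX_gt0 X2 (vexp a); nia.
  rewrite /pruns expnM; apply: hb => //.
  - by apply: size_upd_env => //; apply: leq_trans hva; apply: ltnW.
  - by lia.
  - by move=> z'; case: ifP => _; [lia | have := hrho z'; lia].
  - by move=> z'; case: ifP => _; [lia | exact: hne].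
  - move=> k hk; rewrite /s2 /S.
    do 4![rewrite upd_stack_other; last by apply/eqP; lia].
    by apply: hf; lia.
  - move=> z'; rewrite /s2 /S; case: ifP => [/eqP -> | hz].
      do 2![rewrite upd_stack_other; last by apply/eqP; lia].
      by rewrite upd_stack_same upd_stack_same.
    have hz' := hrho z'; have hzr := hne z'.
    do 4![rewrite upd_stack_other; last by apply/eqP; lia].
    by rewrite upd_stack_other ?hs ?hz.
pose S' i := upd_stack (S va) f.+1 (nseq (va - i) true).
have -> : S va = S' 0 by rewrite /S' subn0 -hclear upd_stack_id.
rewrite (_ : upd_stack s r _ = S' va); last first.
  by rewrite /S' /S !subnn; stores; rewrite hf.
apply: pruns_while => // [|i hi]; first by rewrite /S' subnn upd_stack_same.
exists true, (nseq (va - i.+1) true); split; first by rewrite /S' upd_stack_same nseq_sub.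
by rewrite /S' upd_stack_upd; apply: pruns_skip.
Qed.

Lemma comp_correct e X : 1 < X -> comp_spec X e.
Proof.
elim: e X => [z||a IHa b IHb|a IHa b IHb|a IHa b IHb|z a IHa b IHb|z a IHa] X X2.
- exact: comp_var.
- by move=> rho r f s env *; apply: pruns_push.
- by apply: comp_add; [|exact: IHa|exact: IHb].
- by apply: comp_sub; [|exact: IHa|exact: IHb].
- by apply: comp_mul; [|exact: IHa|exact: IHb].
- by apply: comp_sum; [|exact: IHa|exact: IHb].
- by apply: comp_bit; [|exact: IHa].
Qed.

(** * From expressions to polynomial-time verifiers *)

Definition io_env (x y : bitstring) : nat -> bitstring :=
  fun z => if z == 0 then x else if z == 1 then y else [::].

(* Stack 2 stays empty and serves all unused variables; stack 3 collects the result. *)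
Definition verifier (e : expr) : program :=
  let q := compile (comp (fun z => if z < 2 then z else 2) e 3 4) 0 in
  q ++ [:: Pop 3 (size q).+1 (size q).+2 (size q).+2; Reject; Accept].

Lemma iter_mstep_fix p c n : mstep p c = c -> iter n (mstep p) c = c.
Proof. by move=> h; elim: n => //= n ->. Qed.

(** [Accept] and [Reject] fix the configuration, so the verdict is the same at any time after the
    evaluation; the strict bound leaves a step for the final pop. *)
Lemma verifier_correct e x y T : (size x + size y + 2) ^ texp e < T ->
  accepts_within (verifier e) T x y <-> 0 < eval (io_env x y) e.
Proof.
set X := _ + 2 => hT; have X2 : 1 < X by rewrite /X addn2.
set q := compile (comp (fun z => if z < 2 then z else 2) e 3 4) 0.
have [||||||t ht hexec] := @comp_correct e X X2 (fun z => if z < 2 then z else 2) 3 4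
  (io_env x y) (io_env x y).
- by move=> z; rewrite /io_env; case: eqP => _; [|case: eqP => _]; rewrite /X /=; lia.
- by [].
- by case=> [|[]].
- by case=> [|[]].
- by case=> [|[|[|[]]]].
- by case=> [|[]].
have hq : code_at (verifier e) 0 q by move=> i hi; rewrite add0n nth_cat hi.
have := exec_compile hexec hq; rewrite add0n -/q.
set s' := upd_stack _ _ _ => hrun.
have hnth i : nth Reject (verifier e) (size q + i) =
  nth Reject [:: Pop 3 (size q).+1 (size q).+2 (size q).+2; Reject; Accept] i.
  by rewrite nth_cat ltnNge leq_addr /= addKn.
have hpop : nth Reject (verifier e) (size q) = Pop 3 (size q).+1 (size q).+2 (size q).+2.
  by rewrite -[size q in LHS]addn0 hnth.
pose c1 := mstep (verifier e) (Config (size q) s').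
have hc1 : cur_instr (verifier e) c1 = if 0 < eval (io_env x y) e then Accept else Reject.
  rewrite /c1 (mstep_pop _ hpop) /s' upd_stack_same.
  case: (eval _ _) => [|n] /=; rewrite /cur_instr /=.
    by rewrite -addn1 hnth.
  by rewrite -addn2 hnth.
have hfix : mstep (verifier e) c1 = c1 by rewrite {1}/mstep hc1; case: ifP.
rewrite /accepts_within (_ : T = (T - t.+1) + t.+1); last by rewrite subnK //; lia.
rewrite iterD iterS (_ : init_config x y = Config 0 (io_env x y)) // hrun -/c1.
by rewrite iter_mstep_fix // hc1; case: ifP.
Qed.

Lemma in_NP_of_expr (L : bitstring -> Prop) e c k :
  (forall x y, 0 < eval (io_env x y) e -> L x) ->
  (forall x, L x -> exists y,
     size y <= c * (size x).+1 ^ k /\ 0 < eval (io_env x y) e) ->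
  in_NP L.
Proof.
(* [N] and [d] must dominate both the certificate length and the running time. For the latter,
   [(S + 2) ^ K <= (2 * S.+1) ^ K], and doubling [2 ^ K] makes the bound strict. *)
move=> hsound hcompl; set K := texp e; pose N := c + 2 ^ K.+1; pose d := k + K.+1.
have hT S : (S + 2) ^ K < N * S.+1 ^ d.
  have h1 : (S + 2) ^ K <= (2 * S.+1) ^ K.
    by have [->|hK] := posnP K; rewrite ?expn0 // leq_exp2r //; lia.
  have h2 : S.+1 ^ K <= S.+1 ^ d by rewrite leq_pexp2l // /d; lia.
  have h3 : 0 < S.+1 ^ d by rewrite expn_gt0.
  have h4 : 0 < 2 ^ K by rewrite expn_gt0.
  have h5 := leq_mul (leqnn (2 ^ K)) h2; rewrite expnMn in h1.
  have h6 := leq_mul h4 h3.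
  by rewrite /N mulnDl expnS -mulnA; lia.
exists (verifier e), N, d => x; split=> [/hcompl [y [hy he]] | [y [_]]].
  exists y; split; last by apply/verifier_correct.
  apply: leq_trans hy _; apply: leq_mul; first exact: leq_addr.
  by rewrite leq_pexp2l // /d; lia.
by move/verifier_correct => h; apply/hsound/h.
Qed.

(** * The verification condition *)

Fixpoint Cst (n : nat) : expr := if n is m.+1 then Add One (Cst m) else Sub One One.
(** A condition holds when its value is positive. Then [Mul] is conjunction, and truncated
    subtraction provides negation and comparison. *)
Definition Not a := Sub One a.
Definition Eq a b := Not (Add (Sub a b) (Sub b a)).
Definition Le a b := Sub (Add One b) a.
Definition All z a b := Not (Sum z a (Not b)).

Lemma eval_Cst env n : eval env (Cst n) = n.
Proof. by elim: n => //= n ->. Qed.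

(* Equations for [rewrite], as reduction would also unfold the sums of [Entry]. *)
Lemma eval_Add env a b : eval env (Add a b) = eval env a + eval env b.
Proof. by []. Qed.

Lemma eval_Mul env a b : eval env (Mul a b) = eval env a * eval env b.
Proof. by []. Qed.

Lemma eval_Bit env z a : eval env (Bit z a) = nth false (env z) (eval env a).
Proof. by []. Qed.

Lemma eval_Sum env z a b : eval env (Sum z a b) =
  \sum_(i < eval env a) eval (upd_stack env z (nseq i true)) b.
Proof. by []. Qed.

Lemma eval_One env : eval env One = 1.
Proof. by []. Qed.

Definition evalE := (eval_Add, eval_Mul, eval_Bit, eval_One, eval_Cst).

Lemma eval_Not env a : eval env (Not a) = (eval env a == 0).
Proof. by rewrite /=; case: (eval env a). Qed.

Lemma eval_Eq env a b : eval env (Eq a b) = (eval env a == eval env b).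
Proof. by rewrite eval_Not /= addn_eq0 !subn_eq0 -eqn_leq. Qed.

Lemma sat_And env a b (A B : Prop) :
  (0 < eval env a <-> A) -> (0 < eval env b <-> B) ->
  (0 < eval env (Mul a b) <-> A /\ B).
Proof. by move=> <- <- /=; rewrite muln_gt0; split=> [/andP|[-> ->]]. Qed.

Lemma sat_And3 env a b c (A B C : Prop) :
  (0 < eval env a <-> A) -> (0 < eval env b <-> B) -> (0 < eval env c <-> C) ->
  (0 < eval env (Mul a (Mul b c)) <-> [/\ A, B & C]).
Proof.
move=> ha hb hc; have := sat_And ha (sat_And hb hc).
by move=> [h h']; split=> [/h [? []]|[? ? ?]]; [|apply: h'].
Qed.

Lemma sat_And5 env a b c d e (A B C D E : Prop) :
  (0 < eval env a <-> A) -> (0 < eval env b <-> B) -> (0 < eval env c <-> C) ->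
  (0 < eval env d <-> D) -> (0 < eval env e <-> E) ->
  (0 < eval env (Mul a (Mul b (Mul c (Mul d e)))) <-> [/\ A, B, C, D & E]).
Proof.
move=> ha hb hc hd he; have := sat_And ha (sat_And hb (sat_And3 hc hd he)).
by move=> [h h']; split=> [/h [? [? []]]|[? ? ? ? ?]]; [|apply: h'].
Qed.

Lemma sat_Not env a : 0 < eval env (Not a) <-> eval env a = 0.
Proof. by rewrite eval_Not lt0b; split=> [/eqP|->]. Qed.

Lemma sat_Eq env a b : 0 < eval env (Eq a b) <-> eval env a = eval env b.
Proof. by rewrite eval_Eq lt0b; split=> [/eqP|->]. Qed.

Lemma sat_Le env a b : 0 < eval env (Le a b) <-> eval env a <= eval env b.
Proof. by rewrite /= subn_gt0 add1n ltnS. Qed.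

Lemma sat_All env z a b m (P : nat -> Prop) : eval env a = m ->
  (forall i, 0 < eval (upd_stack env z (nseq i true)) b <-> P i) ->
  (0 < eval env (All z a b) <-> forall i, i < m -> P i).
Proof.
move=> <- h; rewrite sat_Not /=; split=> [h0 i hi | h1].
  apply/h; move/eqP: h0; rewrite sum_nat_eq0 => /forallP /(_ (Ordinal hi)) /=.
  by lia.
by apply: big1 => i _; have /h := h1 i (ltn_ord i); lia.
Qed.

(** * The certificate as an array of unary numbers *)

(** Each table has [B] by [B] entries, each a run of [B] bits. Counting ones makes every bit string
    decode to some tables. *)
Definition cert (B : nat) (y : bitstring) (a i j : nat) : nat :=
  \sum_(b < B) nth false y (((a * B + i) * B + j) * B + b).

Definition mk_cert (B : nat) (g : nat -> nat -> nat -> nat) : bitstring :=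
  mkseq (fun p => p %% B < g (p %/ B %/ B %/ B) (p %/ B %/ B %% B) (p %/ B %% B)) (5 * B ^ 3).

Lemma mk_certK B g a i j : a < 5 -> i < B -> j < B -> g a i j <= B ->
  cert B (mk_cert B g) a i j = g a i j.
Proof.
move=> ha hi hj hg; rewrite /cert.
have hB : 0 < B by lia.
transitivity (\sum_(b < B) (b < g a i j)).
  apply: eq_bigr => b _; rewrite nth_mkseq; last first.
    have hb := ltn_ord b; rewrite !expnS expn0 muln1.
    have h1 : (a * B + i).+1 <= 5 * B by nia.
    have h2 : ((a * B + i) * B + j).+1 <= 5 * B * B by nia.
    by rewrite !mulnA; nia.
  have -> : (((a * B + i) * B + j) * B + b) %/ B = (a * B + i) * B + j.
    by rewrite divnMDl // divn_small ?addn0.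
  have -> : ((a * B + i) * B + j) %/ B = a * B + i by rewrite divnMDl // divn_small ?addn0.
  by rewrite divnMDl // (divn_small hi) addn0 !modnMDl !modn_small.
move: (g a i j) hg => c {g ha hi hj hB}; elim: B c => [|B IH] c hc.
  by rewrite big_ord0; lia.
rewrite big_ord_recr /=; case: (ltnP B c) => h /=; last by rewrite IH ?addn0.
rewrite (_ : c = B.+1); last by lia.
rewrite addn1 -[in RHS](card_ord B) -sum1_card; congr _.+1.
by apply: eq_bigr => b _; rewrite ltnS ltnW.
Qed.

Definition Base := Add One (Var 0).
Definition Entry (a i j : expr) : expr :=
  Sum 2 Base (Bit 1 (Add (Mul (Add (Mul (Add (Mul a Base) i) Base) j) Base) (Var 2))).

(** The hypotheses express that the indices do not depend on variable 2, which [Entry] binds. *)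
Lemma eval_Entry env a i j :
  (forall l, eval (upd_stack env 2 l) a = eval env a) ->
  (forall l, eval (upd_stack env 2 l) i = eval env i) ->
  (forall l, eval (upd_stack env 2 l) j = eval env j) ->
  eval env (Entry a i j) = cert (size (env 0)).+1 (env 1) (eval env a) (eval env i) (eval env j).
Proof.
move=> ha hi hj; rewrite /= add1n; apply: eq_bigr => b _.
by rewrite ha hi hj /= size_nseq.
Qed.

(* Table 0 holds the start of the k-th number of the input, table 1 its number of
   binary digits, table 2 its value shifted right by j, and tables 3 and 4 the
   digits and carries of [flow_ok]; each entry is the number of ones in a row. *)
Definition Start k := Entry (Cst 0) k (Cst 0).
Definition Len k := Entry (Cst 1) k (Cst 0).
Definition Shifted k j := Entry (Cst 2) k j.
Definition Digit j v := Entry (Cst 3) j v.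
Definition Carry j v := Entry (Cst 4) j v.
Definition Num k := Shifted k (Cst 0).
Definition Order := Num (Cst 0).
Definition Succ0 u := Num (Add (Cst 3) (Mul (Cst 2) u)).
Definition Succ1 u := Num (Add (Cst 4) (Mul (Cst 2) u)).

Definition Flag p j := Bit 0 (Add p (Mul (Cst 2) j)).
Definition Value p j := Bit 0 (Add (Add p (Mul (Cst 2) j)) One).

Definition Block k : expr :=
  Mul (All 4 (Len k)
    (Mul (Flag (Start k) (Var 4))
    (Mul (Eq (Shifted k (Var 4))
             (Add (Value (Start k) (Var 4)) (Mul (Cst 2) (Shifted k (Add One (Var 4))))))
      (Shifted k (Var 4)))))
  (Mul (Not (Flag (Start k) (Len k)))
  (Mul (Not (Value (Start k) (Len k)))
    (Not (Shifted k (Len k))))).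

Lemma sat_Block x y k (g := cert (size x).+1 y) :
  0 < eval (upd_stack (io_env x y) 3 (nseq k true)) (Block (Var 3)) <->
  block_ok x (g 0 k 0) (g 1 k 0) (g 2 k).
Proof.
have hP env : env 0 = x -> env 1 = y -> size (env 3) = k -> eval env (Start (Var 3)) = g 0 k 0.
  by move=> h0 h1 h3; rewrite /Start eval_Entry // !eval_Cst h0 h1 /= h3.
have hL env : env 0 = x -> env 1 = y -> size (env 3) = k -> eval env (Len (Var 3)) = g 1 k 0.
  by move=> h0 h1 h3; rewrite /Len eval_Entry // !eval_Cst h0 h1 /= h3.
have hR env j : env 0 = x -> env 1 = y -> size (env 3) = k ->
   (forall l, eval (upd_stack env 2 l) j = eval env j) ->
   eval env (Shifted (Var 3) j) = g 2 k (eval env j).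
  by move=> h0 h1 h3 h; rewrite /Shifted eval_Entry // !eval_Cst h0 h1 /= h3.
apply: sat_And.
  apply: sat_All => [|j].
    by apply: hL; rewrite //= /upd_stack /= size_nseq.
  set env := upd_stack _ 4 _.
  have h0 : env 0 = x by [].
  have h1 : env 1 = y by [].
  have h3 : size (env 3) = k by rewrite /env /upd_stack /= size_nseq.
  have h4 : eval env (Var 4) = j by rewrite /env /= /upd_stack /= size_nseq.
  apply: sat_And3.
  - by rewrite /Flag !evalE h4 hP // h0 lt0b.
  - by rewrite sat_Eq /Value !evalE h4 hP // !hR // !evalE h4 h0.
  - by rewrite hR // h4.
set env := upd_stack _ 3 _.
have h0 : env 0 = x by [].
have h1 : env 1 = y by [].
have h3 : size (env 3) = k by rewrite /env /upd_stack /= size_nseq.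
apply: sat_And3; rewrite sat_Not.
- by rewrite /Flag !evalE hL // hP // h0; case: nth.
- by rewrite /Value !evalE hL // hP // h0; case: nth.
- by rewrite hR // hL.
Qed.

(* Variables 3, 4, 5, 6 are the indices k, j, v, u; the names 0, 1 and 2 are
   those of the instance, of the certificate and of the index bound in [Entry]. *)
Definition Parse : expr :=
  Mul (Eq (Start (Cst 0)) (Cst 0))
  (Mul (Eq (Start (Add (Mul (Cst 2) Order) (Cst 3))) (Var 0))
  (All 3 (Add (Mul (Cst 2) Order) (Cst 3))
    (Mul (Eq (Start (Add One (Var 3)))
             (Add (Add (Start (Var 3)) (Mul (Cst 2) (Len (Var 3)))) (Cst 2)))
         (Block (Var 3))))).

(** After the order come [o], [d] and the [2 * n] switch targets; all of them must be vertices. *)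
Definition Range : expr :=
  All 3 (Add (Mul (Cst 2) Order) (Cst 2)) (Le (Add One (Num (Add One (Var 3)))) Order).

Definition Flow : expr :=
  let o := Num (Cst 1) in let d := Num (Cst 2) in
  let v := Var 5 in let u := Var 6 in let j := Var 4 in
  All 5 Order
    (Mul (Le (Digit (Cst 0) v) One)
    (Mul (Not (Digit (Var 0) v))
    (Mul (Not (Carry (Var 0) v))
    (Mul (Le (Add (Eq v o)
                  (Sum 6 Order (Mul (Mul (Not (Eq u d)) (Eq (Succ0 u) v)) (Digit (Cst 0) u))))
             (Carry (Cst 0) v))
    (All 4 (Var 0)
       (Le (Add (Carry j v)
                (Sum 6 Order (Mul (Mul (Not (Eq u d)) (Digit (Add One j) u))
                               (Add (Eq (Succ0 u) v) (Eq (Succ1 u) v)))))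
           (Add (Digit j v) (Mul (Cst 2) (Carry (Add One j) v))))))))).

Definition Arrival : expr := Mul Parse (Mul Range Flow).

Section Sat.
Variables (x y : bitstring).
Let g := cert (size x).+1 y.

Definition io (env : nat -> bitstring) := env 0 = x /\ env 1 = y.

Lemma eval_Entry_io env a i j : io env ->
  (forall l, eval (upd_stack env 2 l) a = eval env a) ->
  (forall l, eval (upd_stack env 2 l) i = eval env i) ->
  (forall l, eval (upd_stack env 2 l) j = eval env j) ->
  eval env (Entry a i j) = g (eval env a) (eval env i) (eval env j).
Proof. by move=> [h0 h1] *; rewrite eval_Entry // h0 h1. Qed.

Lemma eval_Order env : io env -> eval env Order = g 2 0 0.
Proof. by move=> h; rewrite [eval _ _]eval_Entry_io // !evalE. Qed.

Lemma sat_Parse :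
  0 < eval (io_env x y) Parse <->
  parse_ok x (2 * g 2 0 0 + 3) (fun k => g 0 k 0) (fun k => g 1 k 0) (g 2).
Proof.
have hio : io (io_env x y) by [].
apply: sat_And3.
- by rewrite sat_Eq [X in X = _]eval_Entry_io // !evalE.
- by rewrite sat_Eq [X in X = _]eval_Entry_io // !evalE eval_Order.
apply: sat_All => [|k]; first by rewrite !evalE eval_Order.
apply: sat_And; last exact: sat_Block.
set env := upd_stack _ 3 _.
have hk : eval env (Var 3) = k by rewrite /env /= /upd_stack /= size_nseq.
by rewrite sat_Eq !evalE [X in X = _]eval_Entry_io // !(@eval_Entry_io env) // !evalE hk add1n.
Qed.

Lemma sat_Range :
  0 < eval (io_env x y) Range <-> forall k, k < 2 * g 2 0 0 + 2 -> g 2 k.+1 0 < g 2 0 0.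
Proof.
apply: sat_All => [|k]; first by rewrite !evalE eval_Order.
set env := upd_stack _ 3 _.
have hk : eval env (Var 3) = k by rewrite /env /= /upd_stack /= size_nseq.
by rewrite sat_Le eval_Order // !evalE (@eval_Entry_io env) // !evalE hk !add1n.
Qed.

Lemma sat_Flow :
  0 < eval (io_env x y) Flow <->
  flow_ok (g 2 0 0) (g 2 1 0) (g 2 2 0) (fun u => g 2 (3 + 2 * u) 0)
    (fun u => g 2 (4 + 2 * u) 0) (size x) (g 3) (g 4).
Proof.
apply: sat_All => [|v]; first by rewrite eval_Order.
set env := upd_stack _ 5 _.
have hv : eval env (Var 5) = v by rewrite /env /= /upd_stack /= size_nseq.
have hx : eval env (Var 0) = size x by [].
apply: sat_And5.
- by rewrite sat_Le eval_Entry_io // !evalE hv.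
- by rewrite sat_Not eval_Entry_io // !evalE hv hx.
- by rewrite sat_Not eval_Entry_io // !evalE hv hx.
- rewrite sat_Le eval_Add eval_Eq hv !(@eval_Entry_io env) // hv !evalE eval_Sum eval_Order //.
  under eq_bigr => u _.
    set env' := upd_stack env 6 _.
    have hu : eval env' (Var 6) = u by rewrite /env' /= /upd_stack /= size_nseq.
    have hv' : eval env' (Var 5) = v by rewrite /env' /= /upd_stack /= size_nseq.
    rewrite !eval_Mul eval_Not !eval_Eq eqb0 hu hv' !(@eval_Entry_io env') // !evalE hu.
    over.
  by [].
apply: sat_All => [|j]; first by rewrite hx.
set env1 := upd_stack _ 4 _.
have hj : eval env1 (Var 4) = j by rewrite /env1 /= /upd_stack /= size_nseq.
have hv1 : eval env1 (Var 5) = v by rewrite /env1 /= /upd_stack /= size_nseq.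
rewrite sat_Le !eval_Add !eval_Mul !(@eval_Entry_io env1) // eval_Sum eval_Order // !evalE hj hv1.
under eq_bigr => u _.
  set env' := upd_stack env1 6 _.
  have hu : eval env' (Var 6) = u by rewrite /env' /= /upd_stack /= size_nseq.
  have hv' : eval env' (Var 5) = v by rewrite /env' /= /upd_stack /= size_nseq.
  have hj' : eval env' (Var 4) = j by rewrite /env' /= /upd_stack /= size_nseq.
  rewrite !eval_Mul eval_Not eval_Add !eval_Eq eqb0 hu hv' !(@eval_Entry_io env') // !evalE hu hj'.
  over.
by rewrite add1n.
Qed.

Lemma sat_Arrival : 0 < eval (io_env x y) Arrival <->
  [/\ parse_ok x (2 * g 2 0 0 + 3) (fun k => g 0 k 0) (fun k => g 1 k 0) (g 2),
    forall k, k < 2 * g 2 0 0 + 2 -> g 2 k.+1 0 < g 2 0 0 &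
    flow_ok (g 2 0 0) (g 2 1 0) (g 2 2 0) (fun u => g 2 (3 + 2 * u) 0)
      (fun u => g 2 (4 + 2 * u) 0) (size x) (g 3) (g 4)].
Proof. exact: sat_And3 sat_Parse sat_Range sat_Flow. Qed.

End Sat.

(** * Soundness and completeness of the verification condition *)

Lemma Arrival_sound x y : 0 < eval (io_env x y) Arrival -> ARRIVAL x.
Proof.
move/sat_Arrival; set g := cert _ y; set n := g 2 0 0; pose V k := g 2 k 0.
move=> [hp hV hf].
have hV' k : 0 < k < 2 * n + 3 -> V k < n by case: k => // k hk; apply: hV; lia.
have ho : V 1 < n by apply: hV'; lia.
have hd : V 2 < n by apply: hV'; lia.
have h0 (u : 'I_n) : V (3 + 2 * u) < n by apply: hV'; have := ltn_ord u; lia.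
have h1 (u : 'I_n) : V (4 + 2 * u) < n by apply: hV'; have := ltn_ord u; lia.
pose I := @ArrivalInstance (@SwitchGraph n (fun u => Ordinal (h0 u)) (fun u => Ordinal (h1 u)))
  (Ordinal ho) (Ordinal hd).
have hI : numbering I V by [].
exists I; rewrite (enc_instanceE hI) {1}(parse_sound hp); split=> //.
have [t ht] := @flow_sound n (Ordinal ho) (Ordinal hd) (sg_s0 (ai_G I)) (sg_s1 (ai_G I))
  _ _ _ (fun u => erefl) (fun u => erefl) _ _ hf.
exact: flow_terminates ht.
Qed.

Lemma Arrival_complete n (s0 s1 : 'I_n -> 'I_n) (o d : 'I_n) k0
    (x := enc_instance (@ArrivalInstance (@SwitchGraph n s0 s1) o d)) :
  pos s0 s1 o k0 = d ->
  exists y, size y <= 5 * (size x).+1 ^ 3 /\ 0 < eval (io_env x y) Arrival.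
Proof.
move=> hk0; have [k1 hk1n hk1] := terminates_fast hk0.
have hex : exists i, pos s0 s1 o i == d by exists k1; apply/eqP.
(* At the first visit, no earlier position is [d], and the bound on [k1] carries over. *)
have [k /eqP hk hmin] := ex_minnP hex.
have hkn : k < n * 2 ^ n by apply: leq_ltn_trans hk1n; apply: hmin; apply/eqP.
have hj j : j < k -> pos s0 s1 o j != d.
  by move=> hjk; apply/negP => /hmin; rewrite leqNgt hjk.
have hn : 0 < n by apply: leq_ltn_trans (ltn_ord o).
(* The offset [i'] is [2 * u] or [2 * u + 1], its parity selecting the switch. Indices beyond the
   input give 0, still below [n]. *)
pose V i : nat := match i with
  | 0 => n | 1 => o | 2 => d
  | i'.+3 => if insub i'./2 is Some u then (if odd i' then s1 u else s0 u) : nat else 0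
  end.
have hV0 (u : 'I_n) : V (3 + 2 * u) = s0 u.
  rewrite /V /= add0n mul2n doubleK odd_double insubT //= => hu.
  by congr (val (s0 _)); apply: val_inj.
have hV1 (u : 'I_n) : V (4 + 2 * u) = s1 u.
  rewrite /V /= add0n mul2n uphalf_double odd_double insubT //= => hu.
  by congr (val (s1 _)); apply: val_inj.
have hV i : V i.+1 < n.
  case: i => [|[|i]]; rewrite /V ?ltn_ord //.
  by case: insub => // u; case: odd; rewrite ltn_ord.
have hnum : numbering (@ArrivalInstance (@SwitchGraph n s0 s1) o d) V by [].
have hx := enc_instanceE hnum; rewrite -/x [sg_n _]/= in hx.
clearbody x; clear hnum.
have [P [L [hP hL hparse]]] := parse_complete V (2 * n + 3).
rewrite -hx in hP hL hparse; have hsize := parse_ok_size hparse.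
pose t v := \sum_(i < k.+1) (pos s0 s1 o i == v :> nat).
have [v|v hv|T [C [hflow hT hC]]] := @flow_complete n o d s0 s1
  (fun u => V (3 + 2 * u)) (fun u => V (4 + 2 * u)) (size x) hV0 hV1 t.
- exact: terminates_flow.
(* The counts are at most [n * 2 ^ n], which is below [2 ^ (n + n)], so [size x] columns suffice. *)
- apply: leq_ltn_trans (departures_leq s0 s1 o k.+1 (Ordinal hv)) _.
  apply: leq_ltn_trans hkn _.
  have h2 : 0 < 2 ^ n by rewrite expn_gt0.
  apply: (@leq_trans (2 ^ n * 2 ^ n)); first by rewrite ltn_pmul2r // ltn_expl.
  by rewrite -expnD leq_exp2l //; lia.
pose g a i j := match a with
  | 0 => P i | 1 => L i | 2 => V i %/ 2 ^ j | 3 => T i j | _ => C i j end.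
have hVn i : V i <= n by case: i => // i; apply: ltnW.
pose B := (size x).+1.
have c0 i : i <= 2 * n + 3 -> cert B (mk_cert B g) 0 i 0 = P i.
  by move=> hi; apply: mk_certK => //; [lia | have := hP i hi; rewrite /g /B; lia].
have c1 i : i < 2 * n + 3 -> cert B (mk_cert B g) 1 i 0 = L i.
  by move=> hi; apply: mk_certK => //; [lia | have := hL i hi; rewrite /g /B; lia].
have c2 i j : i < 2 * n + 3 -> j <= size x -> cert B (mk_cert B g) 2 i j = V i %/ 2 ^ j.
  move=> hi hji; apply: mk_certK => //; first by lia.
  by apply: leq_trans (leq_div _ _) _; apply: leq_trans (hVn i) _; rewrite /B; lia.
have c20 i : i < 2 * n + 3 -> cert B (mk_cert B g) 2 i 0 = V i.
  by move=> hi; rewrite c2 // divn1.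
have c3 j v : j <= size x -> v < n -> cert B (mk_cert B g) 3 j v = T j v.
  by move=> hji hv; apply: mk_certK => //; [lia | have := hT j v hv; rewrite /g /B; lia].
have c4 j v : j <= size x -> v < n -> cert B (mk_cert B g) 4 j v = C j v.
  by move=> hji hv; apply: mk_certK => //; [lia | have := hC j v hji hv; rewrite /g /B; lia].
exists (mk_cert B g); split; first by rewrite size_mkseq.
apply/sat_Arrival; rewrite -/B !c20; try lia.
rewrite [V 0]/= [V 1]/= [V 2]/=; split=> [|i hi|].
- apply: parse_ok_ext hparse => // i j hi hji; apply: c2 => //.
  exact: leq_trans hji (hL i hi).
- by rewrite c20 //; lia.
- by apply: flow_ok_ext hflow => // u hu; rewrite c20 //; lia.
Qed.

Theorem theorem2 : in_NP ARRIVAL.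
Proof.
apply: (@in_NP_of_expr _ Arrival 5 3) => [x y|x]; first exact: Arrival_sound.
by move=> [[[n s0 s1] o d] [-> [k hk]]]; apply: Arrival_complete hk.
Qed.
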